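(* Let $S$ be a weak-twist local energy. For every $\nu\in\mathbb{R}\setminus\mathbb{Q}$, the set $\mathcal{BM}_\nu$ of Birkhoff global minimizers of rotation number $\nu$ is strictly ordered: for all $x,y\in\mathcal{BM}_\nu$ with $x\ne y$, either $x\ll y$ or $y\ll x$.
   Context: Let $r\ge1$ be an integer and $K,\lambda>0$. A weak-twist local energy is a function $S\in C^2(\mathbb{R}^{r+1})$ of the form $S(\xi_1,\dots,\xi_{r+1})=\sum_{j=1}^r f_j(\xi_1,\xi_{j+1})$ with $f_j\in C^2(\mathbb{R}^2)$ such that for each $1\le j\le r$: (1) $f_j(\nu+1,\mu+1)=f_j(\nu,\mu)$; (2) $\|\partial_{i,k}f_j\|_{\sup}\le K/r$ for $i,k\in\{1,2\}$; (3) $f_j(\nu,\mu)\to\infty$ as $|\nu-\mu|\to\infty$; and, writing $S_i(x):=S(x_i,\dots,x_{i+r})$ for $x\in\mathbb{R}^{\mathbb{Z}}$ and $\partial_{j,k}$ for second derivatives with respect to $x_j,x_k$, (4) (weak twist) $\partial_{j,k}S_i\le 0$ for all $j\ne k$ and $\partial_{i,i+1}S_i<-\lambda<0$, for all $i\in\mathbb{Z}$. For integers $i_0\le i_1$ let $B=[i_0-r,i_1]\subset\mathbb{Z}$, $\mathring{B}=[i_0,i_1]$ and $W_B(x):=\sum_{i\in B}S_i(x)$. A sequence $x\in\mathbb{R}^{\mathbb{Z}}$ is a global minimizer if $W_B(x)\le W_B(x+v)$ for every such $B$ and every $v$ supported in $\mathring{B}$. $\mathcal{M}$ is the set of global minimizers.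 Order: $x\le y$ means $x_i\le y_i$ for all $i$; $x\ll y$ means $x_i<y_i$ for all $i$. Translations: $(\tau_{k,l}x)_i:=x_{i-k}+l$ for $k,l\in\mathbb{Z}$. A sequence $x$ is Birkhoff if for all $(k,l)\in\mathbb{Z}^2$ either $\tau_{k,l}x\le x$ or $\tau_{k,l}x\ge x$. Every Birkhoff sequence has a rotation number $\rho(x)=\lim_{n\to\pm\infty}x_n/n$. $\mathcal{BM}_\nu$ is the set of Birkhoff sequences in $\mathcal{M}$ with $\rho(x)=\nu$. *)

(* Defs.v *)
From mathcomp Require Import all_boot all_order all_algebra.
From mathcomp Require Import all_classical all_reals all_analysis.

Set Implicit Arguments.
Unset Strict Implicit.
Unset Printing Implicit Defensive.

Import Order.TTheory GRing.Theory Num.Theory.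
Import numFieldNormedType.Exports.

Local Open Scope classical_set_scope.
Local Open Scope ring_scope.

Section WeakTwist.
Variable R : realType.

Definition partial (n : nat) (i : 'I_n) (F : 'rV[R]_n -> R) : 'rV[R]_n -> R :=
  fun z => 'D_(delta_mx 0 i) F z.

Definition has_partial (n : nat) (i : 'I_n) (F : 'rV[R]_n -> R) : Prop :=
  forall z, derivable F z (delta_mx 0 i).

(* Class C^2 on R^n: all partial derivatives of order at most 2 exist
   everywhere and are continuous. *)
Definition C2 (n : nat) (F : 'rV[R]_n -> R) : Prop :=
  [/\ continuous F,
      forall i, has_partial i F /\ continuous (partial i F) &
      forall i k, has_partial i (partial k F) /\
                  continuous (partial i (partial k F))].

Definition point2 (a b : R) : 'rV[R]_2 :=
  \row_(k < 2) if k == 0 then a else b.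

(* [site S i x] is S_i(x) = S(x_i, ..., x_{i+r}). *)
Definition site (r : nat) (S : 'rV[R]_r.+1 -> R) (i : int) (x : int -> R) : R :=
  S (\row_(k < r.+1) x (i + k%:Z)).

Definition update (x : int -> R) (j : int) (t : R) : int -> R :=
  fun i => if i == j then t else x i.

(* Derivative with respect to the variable x_j of a function on R^Z. *)
Definition dseq (j : int) (F : (int -> R) -> R) (x : int -> R) : R :=
  derive1 (fun t : R => F (update x j t)) (x j).

(* The coordinates xi_1, ..., xi_{r+1} are numbered from 0 here, and the
   functions f_1, ..., f_r as well, so that [lift ord0 j], of value j.+1, is
   the second coordinate on which [f j] depends. *)
Definition weak_twist_energy (r : nat) (K lambda : R) (S : 'rV[R]_r.+1 -> R) :
    Prop :=
  [/\ C2 S,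
      exists f : 'I_r -> 'rV[R]_2 -> R,
        (forall xi, S xi =
           \sum_(j < r) f j (point2 (xi 0 ord0) (xi 0 (lift ord0 j)))) /\
        forall j : 'I_r,
          [/\ C2 (f j),
              forall nu mu,
                f j (point2 (nu + 1) (mu + 1)) = f j (point2 nu mu),
              forall (i k : 'I_2) z,
                `|partial i (partial k (f j)) z| <= K / r%:R &
              forall A : R, exists M : R, forall nu mu,
                M <= `|nu - mu| -> A <= f j (point2 nu mu)],
      forall (i j k : int) x, j != k -> dseq j (dseq k (site S i)) x <= 0 &
      forall (i : int) x, dseq i (dseq (i + 1) (site S i)) x < - lambda].

(* For i0 <= i1, the sum of S_i over the i0 - r <= i <= i1. *)
Definition box_energy (r : nat) (S : 'rV[R]_r.+1 -> R) (i0 i1 : int)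
    (x : int -> R) : R :=
  \sum_(k < (`|i1 - i0|%N + r).+1) site S (i0 - r%:Z + k%:Z) x.

Definition global_minimizers (r : nat) (S : 'rV[R]_r.+1 -> R) :
    set (int -> R) :=
  [set x | forall i0 i1 : int, i0 <= i1 ->
     forall v : int -> R, (forall i, ~~ (i0 <= i <= i1) -> v i = 0) ->
       box_energy S i0 i1 x <= box_energy S i0 i1 (fun i => x i + v i)].

Definition seq_le (x y : int -> R) : Prop := forall i, x i <= y i.

Definition seq_ll (x y : int -> R) : Prop := forall i, x i < y i.

Definition translate (k l : int) (x : int -> R) : int -> R :=
  fun i => x (i - k) + l%:~R.

Definition birkhoff (x : int -> R) : Prop :=
  forall k l : int, seq_le (translate k l x) x \/ seq_le x (translate k l x).

(* x_n / n tends to nu both for n -> +oo and for n -> -oo. *)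
Definition has_rotation_number (x : int -> R) (nu : R) : Prop :=
  (fun n : nat => x n%:Z / n%:R) @ \oo --> nu /\
  (fun n : nat => x (- n%:Z) / - n%:R) @ \oo --> nu.

Definition birkhoff_minimizers (r : nat) (S : 'rV[R]_r.+1 -> R) (nu : R) :
    set (int -> R) :=
  [set x | [/\ birkhoff x, global_minimizers S x & has_rotation_number x nu]].

Definition strictly_ordered (A : set (int -> R)) : Prop :=
  forall x y, A x -> A y -> x <> y -> seq_ll x y \/ seq_ll y x.

End WeakTwist.

(* Main.v *)
Require Import Defs.
From mathcomp Require Import all_boot all_order all_algebra.
From mathcomp Require Import all_classical all_reals all_analysis.
From mathcomp Require Import lra ring zify.

(** Write the energy as a sum of pair interactions f_j(x_i, x_{i+j}).  The weak
twist condition makes each f_j submodular, so replacing x and y by min(x, y) and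
max(x, y) never raises the total energy ([window_minmax]), and the strict twist
between neighbours gives a strong maximum principle: two minimizers x <= y that
touch at one site coincide ([ordered_minimizers]).  Hence two minimizers are
comparable as soon as min(x, y) is itself a minimizer ([comparable_of_min]), and
everything comes down to producing such minima.

The tool is a gluing estimate ([gain_bound]).  If x and y are minimizers of the
same rotation number, then a modification of min(x, y) inside a window lowers
the energy by at most a constant times the size of |x - y| near the two ends of
the window: paste the modified minimum into x and the maximum into y.  It is
used twice.
- If |x - y| tends to 0 at both ends of Z, no finite modification of min(x, y)
  lowers the energy, so min(x, y) is a minimizer ([asymptotic_min]).
- In any case |x - y| is bounded, so the total gain is bounded.  If X and Y are
  limits of common translates of x and y by shifts tending to infinity, then a
  gain for min(X, Y) could be realized over and over for min(x, y) on disjoint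
  windows; so min(X, Y) is a minimizer, and X, Y are comparable
  ([recurrent_min]).

For a Birkhoff sequence x of irrational rotation number nu, the translate of x
by (k, l) lies above x when its phase l - k nu is positive.  Take translations
whose phases decrease to 0, and let X and Y be the limits of the translates of x
and y.  For every (k, l), X is comparable with the translate of Y by (k, l).  If
one of these translates of positive phase lies below X, then y <= x; if the same
holds with the roles exchanged, then x <= y; otherwise X = Y.  In that last case
x and y both lie between X and all its translates of negative phase, so where
|x - y| > d there is a gap of length d below X_i.  These gaps are pairwise
disjoint modulo 1, so for a given d > 0 there are only finitely many
([gaps_vanish]), and |x - y| tends to 0. *)

Set Implicit Arguments.
Unset Strict Implicit.
Unset Printing Implicit Defensive.

Import Order.TTheory GRing.Theory Num.Theory.
Import numFieldNormedType.Exports.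

Local Open Scope classical_set_scope.
Local Open Scope ring_scope.

(** * Functions of two real variables with bounded second derivatives *)

Section Calculus.
Variable R : realType.
Implicit Types (h dh : R -> R) (a b c : R).

Lemma MVT_global h dh a b : a <= b -> (forall x : R, is_derive x 1 h (dh x)) ->
  exists2 c, a <= c <= b & h b - h a = dh c * (b - a).
Proof.
move=> ab hd.
have [] := @MVT_segment R h dh a b ab (fun x _ => hd x).
  apply: derivable_within_continuous => x _.
  exact: (@ex_derive _ _ _ _ _ _ _ (hd x)).
by move=> c; rewrite in_itv /= => cab e; exists c.
Qed.

(** The bound on the derivative is only required on a symmetric interval, so that
it can be applied to derivatives that are bounded only locally. *)
Lemma MVT_lipschitz h dh E B a b : (forall x : R, is_derive x 1 h (dh x)) ->
  (forall x, `|x| <= E -> `|dh x| <= B) -> `|a| <= E -> `|b| <= E ->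
  `|h a - h b| <= B * `|a - b|.
Proof.
move=> hd hB; wlog ab : a b / a <= b => [wl aE bE|aE bE].
  have [ab|/ltW ba] := leP a b; first exact: wl.
  by rewrite (distrC (h a)) (distrC a); exact: wl.
have [c /andP[ac cb] e] := MVT_global ab hd.
rewrite distrC e normrM (distrC b) ler_wpM2r// hB//.
move: aE bE; rewrite !ler_norml => /andP[aE _] /andP[_ bE].
by rewrite (le_trans aE)//= (le_trans cb).
Qed.

Lemma is_derive_partial n (i : 'I_n) (f : 'rV[R]_n -> R) (p : R -> 'rV[R]_n) a :
  has_partial i f -> (forall c, p (c + a) = c *: delta_mx 0 i + p a) ->
  is_derive a 1 (f \o p) (partial i f (p a)).
Proof.
move=> fd pE.
have e : (fun c : R => c^-1 *: (((f \o p) \o shift a) (c *: 1) - (f \o p) a)) =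
         (fun c : R => c^-1 *: ((f \o shift (p a)) (c *: delta_mx 0 i) - f (p a))).
  by apply/funext => c /=; rewrite [c *: 1]mulr1 pE.
split; first by have := fd (p a); rewrite /derivable e.
by rewrite /partial /derive e.
Qed.

Lemma point2_shift1 a b c : point2 (c + a) b = c *: delta_mx 0 0 + point2 a b.
Proof.
apply/rowP => k; rewrite !mxE /=.
by case: k => [[|[|]]] //= ?; rewrite ?mulr0 ?add0r ?mulr1.
Qed.

Lemma point2_shift2 a b c : point2 a (c + b) = c *: delta_mx 0 1 + point2 a b.
Proof.
apply/rowP => k; rewrite !mxE /=.
by case: k => [[|[|]]] //= ?; rewrite ?mulr0 ?add0r ?mulr1.
Qed.

Section TwoVariables.
Variables (f : 'rV[R]_2 -> R) (f2 : C2 f).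

Let fp i : has_partial i f. Proof. by case: f2 => _ /(_ i)[]. Qed.
Let fpp i k : has_partial i (partial k f). Proof. by case: f2 => _ _ /(_ i k)[]. Qed.

Lemma is_derive_first (g : 'rV[R]_2 -> R) b a : has_partial 0 g ->
  is_derive a 1 (fun t => g (point2 t b)) (partial 0 g (point2 a b)).
Proof.
move=> gp; apply: (@is_derive_partial _ 0 g (fun t => point2 t b)) => // c.
exact: point2_shift1.
Qed.

Lemma is_derive_second (g : 'rV[R]_2 -> R) a b : has_partial 1 g ->
  is_derive b 1 (fun t => g (point2 a t)) (partial 1 g (point2 a b)).
Proof.
move=> gp; apply: (@is_derive_partial _ 1 g (fun t => point2 a t)) => // c.
exact: point2_shift2.
Qed.

(** Two applications of the mean value theorem turn the sign of the mixed second
derivative into submodularity, with a quantitative gain [c]. *)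
Lemma mixed_difference c :
  (forall a b, partial 0 (partial 1 f) (point2 a b) <= - c) ->
  forall a a' b b', a <= a' -> b <= b' ->
  f (point2 a b) + f (point2 a' b') + c * ((a' - a) * (b' - b)) <=
  f (point2 a b') + f (point2 a' b).
Proof.
move=> fc a a' b b' aa' bb'.
pose g t := f (point2 a' t) - f (point2 a t).
pose dg t := partial 1 f (point2 a' t) - partial 1 f (point2 a t).
have gd (x : R) : is_derive x 1 g (dg x).
  apply: is_deriveB; exact: is_derive_second.
have [t _ gt] := MVT_global bb' gd.
have [u _ hu] := MVT_global aa' (fun x => @is_derive_first _ t x (@fpp 0 1)).
have : dg t * (b' - b) <= - c * ((a' - a) * (b' - b)).
  by rewrite /dg hu -mulrA ler_wpM2r// mulr_ge0// subr_ge0.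
rewrite -gt /g; lra.
Qed.

(** Bounded second derivatives make the gradient grow at most linearly; by diagonal
periodicity a point of the strip |a - b| <= D may be moved to 0 <= a <= 1, where
linear growth means boundedness. *)
Lemma local_lipschitz (B D : R) :
  (forall a b, f (point2 (a + 1) (b + 1)) = f (point2 a b)) ->
  (forall i k z, `|partial i (partial k f) z| <= B) -> 0 <= D ->
  exists2 C : R, 0 <= C & forall a b a' b',
    `|a - b| <= D -> `|a - a'| <= D -> `|b - b'| <= D ->
    `|f (point2 a b) - f (point2 a' b')| <= C * (`|a - a'| + `|b - b'|).
Proof.
move=> fper fB D0.
have fperz a b (n : int) : f (point2 (a + n%:~R) (b + n%:~R)) = f (point2 a b).
  have fpern (m : nat) u v : f (point2 (u + m%:R) (v + m%:R)) = f (point2 u v).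
    elim: m => [|m ih]; first by rewrite !addr0.
    by rewrite -natr1 !addrA fper.
  case: n => n; first exact: fpern.
  by rewrite -(fpern n.+1) NegzE mulrNz !subrK.
pose E := 1 + 2 * D.
have B0 : 0 <= B by apply: le_trans (fB 0 0 0); exact: normr_ge0.
have pB i a b : `|a| <= E -> `|b| <= E ->
    `|partial i f (point2 a b)| <= `|partial i f (point2 0 0)| + 2 * (B * E).
  move=> aE bE.
  have E0 : `|0 : R| <= E by rewrite normr0; apply: le_trans aE.
  have h1 := @MVT_lipschitz (fun t => partial i f (point2 t b)) _ E B a 0
    (fun x => @is_derive_first _ b x (@fpp 0 i)) (fun _ _ => fB _ _ _) aE E0.
  have h2 := @MVT_lipschitz (fun t => partial i f (point2 0 t)) _ E B b 0
    (fun x => @is_derive_second _ 0 x (@fpp 1 i)) (fun _ _ => fB _ _ _) bE E0.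
  rewrite !subr0 in h1 h2.
  have h3 : B * `|a| <= B * E by rewrite ler_wpM2l.
  have h4 : B * `|b| <= B * E by rewrite ler_wpM2l.
  move: h1 h2; rewrite !ler_norml => /andP[? ?] /andP[? ?].
  have := ler_norm (partial i f (point2 0 0)).
  have := ler_norm (- partial i f (point2 0 0)); rewrite normrN.
  by move=> ? ?; apply/andP; split; lra.
pose C := `|partial 0 f (point2 0 0)| + `|partial 1 f (point2 0 0)| + 2 * (B * E).
have C0 : 0 <= C by rewrite /C !addr_ge0// mulr_ge0// mulr_ge0// /E; lra.
exists C => // a b a' b'; wlog a01 : a b a' b' / 0 <= a <= 1 => [wl|].
  move=> h1 h2 h3.
  pose n := Num.floor a.
  have /andP[n1 n2] := floor_itv a.
  have := wl (a - n%:~R) (b - n%:~R) (a' - n%:~R) (b' - n%:~R).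
  have e (u v : R) : u - n%:~R - (v - n%:~R) = u - v by ring.
  rewrite !e -mulrNz !fperz; apply=> //.
  rewrite mulrNz subr_ge0 n1 /= lerBlDr ltW//.
  by move: n2; rewrite intrD addrC.
move=> ab aa' bb'; move: (a01) (ab) (aa') (bb').
rewrite !ler_norml => /andP[? ?] /andP[? ?] /andP[? ?] /andP[? ?].
have [aE bE aE' bE'] : [/\ `|a| <= E, `|b| <= E, `|a'| <= E & `|b'| <= E].
  by rewrite !ler_norml /E; split; apply/andP; split; lra.
have h1 : `|f (point2 a b) - f (point2 a' b)| <= C * `|a - a'|.
  apply: (@MVT_lipschitz (fun t => f (point2 t b)) _ E C a a'
    (fun x => @is_derive_first _ b x (@fp 0))) => // x xE.
  by apply: le_trans (pB 0 _ _ xE bE) _; rewrite lerD2r lerDl.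
have h2 : `|f (point2 a' b) - f (point2 a' b')| <= C * `|b - b'|.
  apply: (@MVT_lipschitz (fun t => f (point2 a' t)) _ E C b b'
    (fun x => @is_derive_second _ a' x (@fp 1))) => // x xE.
  by apply: le_trans (pB 1 _ _ aE' xE) _; rewrite lerD2r lerDr.
rewrite -ler_norml mulrDr; apply: le_trans (lerD h1 h2).
by apply: le_trans (ler_normD _ _); rewrite addrA subrK.
Qed.

End TwoVariables.
End Calculus.

(** * The energy as a sum of pair interactions *)

(** All that the dynamical part uses of the functions f_j: no second derivative
occurs any more.  The interaction of index 0 is the one between neighbours, which
alone satisfies the strict twist condition. *)
Record twist_coupling (R : realType) (r : nat) (lam : R)
    (F : 'I_r -> R -> R -> R) : Prop := TwistCoupling {
  coupling_periodic : forall j a b, F j (a + 1) (b + 1) = F j a b;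
  coupling_twist : forall (j : 'I_r) a a' b b', a <= a' -> b <= b' ->
    F j a b + F j a' b' + (if j == 0%N :> nat then lam else 0) * ((a' - a) * (b' - b))
      <= F j a b' + F j a' b;
  coupling_derivable1 : forall j (b a : R), derivable (fun t => F j t b) a 1;
  coupling_derivable2 : forall j (a b : R), derivable (F j a) b 1;
  coupling_lipschitz : forall D : R, 0 <= D -> exists2 C : R, 0 <= C &
    forall j a b a' b', `|a - b| <= D -> `|a - a'| <= D -> `|b - b'| <= D ->
      `|F j a b - F j a' b'| <= C * (`|a - a'| + `|b - b'|)
}.

Section Bridge.
Variables (R : realType) (r : nat).

Definition coupling_energy (F : 'I_r -> R -> R -> R) (i : int) (x : int -> R) :=
  \sum_(j < r) F j (x i) (x (i + j.+1%:Z)).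

(** In the sum over j, only the interaction of index j depends jointly on x_0 and
x_{j+1}; so the mixed derivative of the energy in these two variables is that of
the single function f_j, and the twist hypotheses pass to each f_j. *)
Lemma weak_twist_coupling (K lambda : R) (S : 'rV[R]_r.+1 -> R) :
  weak_twist_energy K lambda S ->
  exists2 F : 'I_r -> R -> R -> R, twist_coupling lambda F &
    forall i x, site S i x = coupling_energy F i x.
Proof.
case=> _ [f [Sf fP]] twist0 twist1.
pose F j a b := f j (point2 a b).
have siteE i x : site S i x = coupling_energy F i x.
  rewrite /site Sf; apply: eq_bigr => j _; rewrite /F.
  by rewrite !mxE /= addr0.
exists F => //.
have f2 j : C2 (f j) by case: (fP j).
(* At the sequence equal to s at site 0 and to t elsewhere, in particular at
j + 1. *)
have mixedE (j : 'I_r) (s t : R) :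
    dseq 0 (dseq (0 + j.+1%:Z) (site S 0)) (fun i => if i == 0 then s else t) =
    partial 0 (partial 1 (f j)) (point2 s t).
  have j0 : (j.+1%:Z == 0) = false by [].
  have inner x : dseq (0 + j.+1%:Z) (site S 0) x =
      partial 1 (f j) (point2 (x 0) (x j.+1%:Z)).
    rewrite /dseq add0r derive1E.
    pose h (u : R) := F j (x 0) u.
    pose c : R := \sum_(k < r | k != j) F k (x 0) (x k.+1%:Z).
    rewrite (_ : (fun u : R => _) = h \+ cst c); last first.
      apply/funext => u; rewrite siteE /coupling_energy (bigD1 j)//=.
      rewrite /update add0r eqxx eq_sym j0 /h; congr (_ + _).
      apply: eq_bigr => k kj; rewrite add0r ifF//.
      by apply/negP => /eqP[] /val_inj /eqP; rewrite (negbTE kj).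
    have hd := @is_derive_second R (f j) (x 0) (x j.+1%:Z)
      (let: And3 _ fp _ := f2 j in proj1 (fp 1)).
    have := is_deriveD hd (is_derive_cst c (x j.+1%:Z) 1).
    by move=> /@derive_val ->; rewrite addr0.
  rewrite {1}/dseq (_ : (fun u : R => _) = fun u => partial 1 (f j) (point2 u t)).
    have hd := @is_derive_first R (partial 1 (f j)) t s
      (let: And3 _ _ fp := f2 j in proj1 (fp 0 1)).
    by rewrite derive1E /= (@derive_val _ _ _ _ _ _ _ hd).
  by apply/funext => u; rewrite inner /update eqxx j0.
split.
- by move=> j a b; case: (fP j) => _ fper _ _; exact: fper.
- move=> j a a' b b' aa' bb'; apply: mixed_difference => // s t.
  rewrite -mixedE; case: ifP => [/eqP j0|_].
    by rewrite ltW// j0; exact: twist1.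
  by rewrite oppr0; apply: twist0; rewrite add0r.
- move=> j b a; case: (f2 j) => _ fp _.
  exact: (@ex_derive _ _ _ _ _ _ _ (is_derive_first b a (proj1 (fp 0)))).
- move=> j a b; case: (f2 j) => _ fp _.
  exact: (@ex_derive _ _ _ _ _ _ _ (is_derive_second a b (proj1 (fp 1)))).
- move=> D D0.
  have /choice[C CP] : forall j, exists C, 0 <= C /\ forall a b a' b',
      `|a - b| <= D -> `|a - a'| <= D -> `|b - b'| <= D ->
      `|F j a b - F j a' b'| <= C * (`|a - a'| + `|b - b'|).
    move=> j; have [f2j fper fB _] := fP j.
    by have [C ? ?] := local_lipschitz f2j fper fB D0; exists C.
  exists (\sum_j C j); first by apply: sumr_ge0 => j _; case: (CP j).
  move=> j a b a' b' h1 h2 h3; have [_ h] := CP j.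
  apply: le_trans (h _ _ _ _ h1 h2 h3) _.
  rewrite ler_wpM2r// (bigD1 j)//= lerDl.
  by apply: sumr_ge0 => k _; case: (CP k).
Qed.

End Bridge.

(** * Minimizers and the strong maximum principle *)

Definition seq_min (R : realType) (x y : int -> R) : int -> R :=
  fun i => Num.min (x i) (y i).
Definition seq_max (R : realType) (x y : int -> R) : int -> R :=
  fun i => Num.max (x i) (y i).

(** At a minimum the derivative vanishes, so the function cannot grow linearly
to the right of it. *)
Lemma slope_at_min (R : realType) (h : R -> R) (a c : R) :
  (forall t : R, derivable h t 1) -> (forall t, h a <= h t) ->
  (forall t, a < t -> c * (t - a) <= h t - h a) -> c <= 0.
Proof.
move=> hd hmin hc; rewrite leNgt; apply/negP => c0.
have [] := @derive1_at_min R h (a - 1) (a + 1) a.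
- lra.
- by move=> t _; exact: hd.
- by rewrite in_itv /=; apply/andP; split; lra.
- by move=> t _; exact: hmin.
move=> hda hd0.
have : (fun u : R => u^-1 *: ((h \o shift a) (u *: 1) - h a)) @ 0^' --> 'D_1 h a.
  exact: hda.
rewrite hd0 => /cvgrPdist_lt /(_ c c0) [e /= e0 he].
have e20 : 0 < e / 2 by lra.
have /= := he (e / 2); rewrite /ball_ /= !sub0r !normrN.
rewrite (gtr0_norm e20) => H.
have {}H := H (ltac:(lra)) (lt0r_neq0 e20); move: H.
rewrite [_ *: 1]mulr1 [_ *: _]mulrC.
have h1 := hc (e / 2 + a); rewrite addrK in h1.
have {}h1 : c * (e / 2) <= h (e / 2 + a) - h a by apply: h1; lra.
have h2 : c <= (h (e / 2 + a) - h a) / (e / 2) by rewrite ler_pdivlMr.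
rewrite ltNge => /negP; apply; exact: le_trans h2 (ler_norm _).
Qed.

Section Windows.
Variables (R : realType) (r : nat) (F : 'I_r -> R -> R -> R).
Implicit Types (x y z : int -> R) (a i j k : int) (n : nat).

Local Notation s := (coupling_energy F).

Definition window_energy a n x : R := \sum_(k < n) s (a + k%:Z) x.
Local Notation W := window_energy.

Lemma coupling_energy_local i x z :
  (forall j, i <= j <= i + r%:Z -> x j = z j) -> s i x = s i z.
Proof.
move=> xz; apply: eq_bigr => j _.
have jr := ltn_ord j.
by rewrite !xz//; lia.
Qed.

Lemma window_energy_cat a m n x : W a (m + n) x = W a m x + W (a + m%:Z) n x.
Proof.
rewrite /W big_split_ord /=; congr (_ + _).
by apply: eq_bigr => i _; rewrite PoszD addrA.
Qed.

Lemma window_energy_local a n x z :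
  (forall j, a <= j < a + n%:Z + r%:Z -> x j = z j) -> W a n x = W a n z.
Proof.
move=> xz; apply: eq_bigr => k _; apply: coupling_energy_local => j jk.
have kn := ltn_ord k.
by apply: xz; lia.
Qed.

(** The windows of sites [a, a + n) contain every site whose energy depends on one
of the allowed coordinates, those in [a + r, a + n). *)
Definition differ_within a n x z : Prop :=
  forall i, z i != x i -> a + r%:Z <= i < a + n%:Z.

(** Energy differences of finite modifications do not depend on the window in
which they are computed. *)
Lemma window_energy_enlarge a n a' n' x z : differ_within a n x z ->
  a' <= a -> a + n%:Z <= a' + n'%:Z ->
  W a' n' x - W a' n' z = W a n x - W a n z.
Proof.
move=> xz a'a nn'.
have xzE i : (i < a + r%:Z) || (a + n%:Z <= i) -> x i = z i.
  by move=> ih; apply/eqP; rewrite eq_sym; apply/negP => /negP /xz; lia.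
have -> : n' = (absz (a - a')%R + (n + absz (a' + n'%:Z - a - n%:Z)%R))%N by lia.
rewrite !window_energy_cat.
have -> : a' + (absz (a - a')%R)%:Z = a by lia.
rewrite (@window_energy_local a' _ x z); last by move=> j jh; apply: xzE; lia.
rewrite (@window_energy_local (a + n%:Z) _ x z); first by ring.
by move=> j jh; apply: xzE; lia.
Qed.

Definition minimizer x :=
  forall a n z, differ_within a n x z -> W a n x <= W a n z.

End Windows.

(** When the two differences have opposite signs, min and max really exchange the
two coordinates and the twist inequality applies; otherwise they only permute
the two pairs. *)
Lemma pair_minmax (R : realType) (c : R) (G : R -> R -> R) : 0 <= c ->
  (forall a a' b b' : R, a <= a' -> b <= b' ->
    G a b + G a' b' + c * ((a' - a) * (b' - b)) <= G a b' + G a' b) ->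
  forall a b a' b' : R,
  G (Num.min a a') (Num.min b b') + G (Num.max a a') (Num.max b b')
    - c * ((a - a') * (b - b')) <= G a b + G a' b'.
Proof.
move=> c0 h a b a' b'.
have [aa'|/ltW a'a] := leP a a'; have [bb'|/ltW b'b] := leP b b'.
- suff: 0 <= c * ((a - a') * (b - b')) by lra.
  by rewrite mulr_ge0// -mulrNN mulr_ge0//; lra.
- by have := h _ _ _ _ aa' b'b; lra.
- by have := h _ _ _ _ a'a bb'; lra.
- suff: 0 <= c * ((a - a') * (b - b')) by lra.
  by rewrite mulr_ge0// mulr_ge0//; lra.
Qed.

Section Energy.
Variables (R : realType) (r : nat) (lam : R) (F : 'I_r -> R -> R -> R).
Hypotheses (r_gt0 : (0 < r)%N) (lam_gt0 : 0 < lam).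
Hypothesis hF : twist_coupling lam F.
Implicit Types (x y z : int -> R) (a i j k : int) (n : nat).

Local Notation s := (coupling_energy F).
Local Notation W := (window_energy F).
Local Notation minimizer := (minimizer F).

(** The gain comes from the interaction between the neighbours i and i + 1.  If
x and y do not cross between i and i + 1, the correction term is nonpositive and
the plain inequality is the better one. *)
Lemma energy_minmax_twist i x y :
  s i (seq_min x y) + s i (seq_max x y)
    - lam * ((x i - y i) * (x (i + 1) - y (i + 1))) <= s i x + s i y.
Proof.
pose c (j : 'I_r) : R := if j == 0%N :> nat then lam else 0.
have -> : lam * ((x i - y i) * (x (i + 1) - y (i + 1))) =
    \sum_(j < r) c j * ((x i - y i) * (x (i + j.+1%:Z) - y (i + j.+1%:Z))).
  rewrite (bigD1 (Ordinal r_gt0))//= big1 ?addr0 /c//= => j j0.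
  rewrite ifF ?mul0r//; apply/negP => /eqP j00.
  by move: j0; rewrite -val_eqE /= j00.
rewrite -!big_split -sumrN -big_split /=; apply: ler_sum => j _.
apply: (pair_minmax _ (coupling_twist hF j)).
by case: ifP => // _; exact: ltW.
Qed.

Lemma energy_minmax i x y :
  s i (seq_min x y) + s i (seq_max x y) <= s i x + s i y.
Proof.
rewrite -!big_split; apply: ler_sum => j _.
have := @pair_minmax R 0 (F j) (lexx _) _ (x i) (x (i + j.+1%:Z)) (y i)
  (y (i + j.+1%:Z)).
rewrite mul0r subr0; apply=> a a' b b' aa' bb'.
apply: le_trans (coupling_twist hF j aa' bb').
rewrite lerD2l ler_wpM2r ?mulr_ge0 ?subr_ge0//.
by case: ifP => // _; exact: ltW.
Qed.

Lemma window_minmax a n x y :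
  W a n (seq_min x y) + W a n (seq_max x y) <= W a n x + W a n y.
Proof.
by rewrite -!big_split; apply: ler_sum => k _; exact: energy_minmax.
Qed.

Lemma window_minmax_twist a n x y i : a <= i < a + n%:Z ->
  W a n (seq_min x y) + W a n (seq_max x y)
    - lam * ((x i - y i) * (x (i + 1) - y (i + 1))) <= W a n x + W a n y.
Proof.
move=> /andP[ai ian].
have -> : n = (absz (i - a)%R + (1 + absz (a + n%:Z - i - 1)%R))%N by lia.
rewrite !window_energy_cat.
have -> : a + (absz (i - a)%R)%:Z = i by lia.
have W1 x' : W i 1 x' = s i x' by rewrite /W big_ord1 addr0.
rewrite !W1.
have := window_minmax a (absz (i - a)%R) x y.
have := window_minmax (i + 1%N%:Z) (absz (a + n%:Z - i - 1)%R) x y.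
have := energy_minmax_twist i x y.
lra.
Qed.

Lemma derivable_update_energy i k x (t : R) :
  derivable (fun t : R => s i (update x k t)) t 1.
Proof.
rewrite (_ : (fun t => _) = \sum_(j < r)
   (fun t => F j (update x k t i) (update x k t (i + j.+1%:Z)))); last first.
  by apply/funext => u; rewrite fct_sumE.
apply: derivable_sum => j.
rewrite /update; have [ik|ik] := eqVneq i k.
  rewrite (_ : (i + j.+1%:Z == k) = false); first exact: (coupling_derivable1 hF).
  by apply/negP => /eqP; lia.
have [jk|jk] := eqVneq (i + j.+1%:Z) k.
  exact: (coupling_derivable2 hF).
exact: derivable_cst.
Qed.

(** Raise x to the value t at the touching site k, obtaining u.  Then min(u, y) = x
and max(u, y) is y raised to t at k.  Since y is a minimizer, the twist
inequality makes the energy of u exceed that of x by at least a multiple of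
(t - x_k)(y_j - x_j), for either neighbour j of k; as x is a minimizer this
energy is stationary at t = x_k, which forces y_j = x_j. *)
Lemma touching_minimizers x y k : minimizer x -> minimizer y -> seq_le x y ->
  x k = y k -> x (k + 1) = y (k + 1) /\ x (k - 1) = y (k - 1).
Proof.
move=> mx my xy xyk.
(* The energy of all sites that see the coordinate k. *)
pose E x t := W (k - r%:Z) r.+1 (update x k t).
have updE z : update z k (z k) = z.
  by apply/funext => i; rewrite /update; case: eqP => // ->.
have Emin z : minimizer z -> forall t, E z (z k) <= E z t.
  move=> mz t; rewrite /E updE; apply: mz => i.
  rewrite /update; have [->|] := eqVneq i k; first by move=> _; lia.
  by rewrite eqxx.
have Ed t : derivable (E x) t 1.
  rewrite /E /W (_ : (fun t => _) = \sum_(j < r.+1)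
     (fun t => s (k - r%:Z + j%:Z) (update x k t))); last first.
    by apply/funext => u; rewrite fct_sumE.
  by apply: derivable_sum => j; exact: derivable_update_energy.
have key i t : x k < t -> k - 1 <= i <= k ->
    E x (x k) - lam * ((update x k t i - y i) *
      (update x k t (i + 1) - y (i + 1))) <= E x t.
  move=> kt ik; have := Emin _ my t.
  have := @window_minmax_twist (k - r%:Z) r.+1 (update x k t) y i _.
  have -> : seq_min (update x k t) y = x.
    apply/funext => j; rewrite /seq_min /update; case: eqP => [->|_].
      by rewrite min_r ?xyk// -xyk ltW.
    by rewrite min_l.
  have -> : seq_max (update x k t) y = update y k t.
    apply/funext => j; rewrite /seq_max /update; case: eqP => [->|_].
      by rewrite max_l// -xyk ltW.
    by rewrite max_r.
  rewrite /E !updE => h1 h2; have {}h1 := h1 _.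
  have : k - r%:Z <= i < k - r%:Z + r.+1%:Z by lia.
  by move=> /h1; lra.
have side j :
    (forall t, x k < t -> E x (x k) + lam * ((t - x k) * (y j - x j)) <= E x t) ->
    x j = y j.
  move=> h; apply/eqP; rewrite eq_le xy /= -subr_le0 -(pmulr_rle0 _ lam_gt0).
  apply: (slope_at_min Ed (Emin _ mx)) => t xt.
  by have := h _ xt; lra.
split; apply: side => t xt.
- have := key k t xt; rewrite /update eqxx -xyk ifF; last by apply/negP => /eqP; lia.
  move=> /(_ _); rewrite lexx andbT => /(_ _)/wrap[]; first by lia.
  by lra.
- have := key (k - 1) t xt; rewrite /update subrK eqxx -xyk.
  rewrite ifF; last by apply/negP => /eqP; lia.
  move=> /(_ _); rewrite lexx /= => /(_ _)/wrap[]; first by lia.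
  by lra.
Qed.

Lemma ordered_minimizers x y : minimizer x -> minimizer y -> seq_le x y ->
  x = y \/ seq_ll x y.
Proof.
move=> mx my xy.
have [[k xyk]|nxy] := pselect (exists k, x k = y k); [left|right]; last first.
  move=> i; rewrite lt_neqAle xy andbT; apply/eqP => xyi; apply: nxy.
  by exists i.
have up n : x (k + n%:Z) = y (k + n%:Z).
  elim: n => [|n ih]; first by rewrite addr0.
  have [] := touching_minimizers mx my xy ih.
  by rewrite -addrA (_ : n%:Z + 1 = n.+1%:Z)//; lia.
have dn n : x (k - n%:Z) = y (k - n%:Z).
  elim: n => [|n ih]; first by rewrite subr0.
  have [_] := touching_minimizers mx my xy ih.
  by rewrite -addrA (_ : - n%:Z - 1 = - n.+1%:Z)//; lia.
apply/funext => i; have [ki|ik] := leP k i.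
  by have := up (absz (i - k)%R); rewrite (_ : k + (absz (i - k)%R)%:Z = i)//; lia.
by have := dn (absz (k - i)%R); rewrite (_ : k - (absz (k - i)%R)%:Z = i)//; lia.
Qed.

(** The minimum lies below x, hence equals x or is strictly below x everywhere;
in the second case it equals y. *)
Lemma comparable_of_min x y : minimizer x -> minimizer y ->
  minimizer (seq_min x y) -> seq_le x y \/ seq_le y x.
Proof.
move=> mx my mm.
have lex : seq_le (seq_min x y) x by move=> i; rewrite /seq_min ge_min lexx.
have [e|lt] := ordered_minimizers mm mx lex; [left|right] => i.
  by rewrite -e /seq_min ge_min lexx orbT.
have := lt i; rewrite /seq_min.
by case: (leP (x i) (y i)) => [_|/ltW//]; rewrite ltxx.
Qed.

Lemma coupling_cvg (j : 'I_r) (u v : nat -> R) (p q : R) :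
  u @ \oo --> p -> v @ \oo --> q -> (fun n => F j (u n) (v n)) @ \oo --> F j p q.
Proof.
move=> up vq.
have D0 : 0 <= `|p - q| + 1 by rewrite addr_ge0.
have [C C0 FC] := coupling_lipschitz hF D0.
apply/cvgrPdist_le => e e0.
have d0 : 0 < Num.min 1 (e / (2 * (C + 1))).
  by rewrite lt_min ltr01 divr_gt0//; lra.
have nu := (cvgrPdist_le _ _).1 up _ d0.
have nv := (cvgrPdist_le _ _).1 vq _ d0.
near=> n.
have : `|p - u n| <= Num.min 1 (e / (2 * (C + 1))) by near: n; exact: nu.
have : `|q - v n| <= Num.min 1 (e / (2 * (C + 1))) by near: n; exact: nv.
rewrite !le_min => /andP[q1 q2] /andP[p1 p2].
have le1 t : t <= 1 -> t <= `|p - q| + 1 by move=> ?; rewrite ler_wpDl.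
apply: le_trans (FC _ _ _ _ _ _ (le1 _ p1) (le1 _ q1)) _; first by rewrite lerDl.
have h1 : `|p - u n| + `|q - v n| <= e / (C + 1).
  rewrite (_ : e / (C + 1) = e / (2 * (C + 1)) + e / (2 * (C + 1))) ?lerD//.
  by field; lra.
apply: le_trans (ler_wpM2l C0 h1) _.
by rewrite mulrCA ger_pMr// ler_pdivrMr ?mul1r; lra.
Unshelve. all: by end_near. Qed.

Lemma window_energy_cvg a n (u : nat -> int -> R) x :
  (forall i, (fun m => u m i) @ \oo --> x i) ->
  (fun m => W a n (u m)) @ \oo --> W a n x.
Proof.
move=> ux; apply: cvg_big => [|k _]; first exact: add_continuous.
apply: cvg_big => [|j _]; first exact: add_continuous.
exact: coupling_cvg.
Qed.

Lemma minimizer_lim (u : nat -> int -> R) x : (forall m, minimizer (u m)) ->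
  (forall i, (fun m => u m i) @ \oo --> x i) -> minimizer x.
Proof.
move=> mu ux a n z xz.
pose v m i := u m i + (z i - x i).
have vz i : (fun m => v m i) @ \oo --> z i.
  rewrite -[X in _ --> X](_ : x i + (z i - x i) = z i); last by ring.
  by apply: cvgD => //; exact: cvg_cst.
apply: (ler_cvg_to (window_energy_cvg ux) (window_energy_cvg vz)).
apply: nearW => m; apply: mu => i; rewrite /v => h; apply: xz.
by apply: contra h => /eqP ->; rewrite subrr addr0.
Qed.

End Energy.

(** * Rotation numbers and phases of translations *)

Section Rotation.
Variables (R : realType) (nu : R).
Implicit Types (x y z : int -> R) (i j k l : int) (n : nat).

(** The amount by which the translation by (k, l) shifts, on average, a sequence
of rotation number nu. *)
Definition phase k l : R := l%:~R - k%:~R * nu.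

(** The only trace of the Birkhoff property and of the rotation number that the
rest of the proof uses. *)
Definition rotation_monotone x :=
  forall k l, 0 < phase k l -> seq_le x (translate k l x).

Lemma phaseD k l k' l' : phase (k + k') (l + l') = phase k l + phase k' l'.
Proof. by rewrite /phase !intrD; ring. Qed.

Lemma phaseN k l : phase (- k) (- l) = - phase k l.
Proof. by rewrite /phase !intrN; ring. Qed.

Lemma translateD k l k' l' x :
  translate k l (translate k' l' x) = translate (k + k') (l + l') x.
Proof.
by apply/funext => i; rewrite /translate -addrA (addrC l'%:~R) intrD opprD !addrA.
Qed.

Lemma translate0 x : translate 0 0 x = x.
Proof. by apply/funext => i; rewrite /translate subr0 addr0. Qed.

Lemma translate_le k l x y : seq_le x y -> seq_le (translate k l x) (translate k l y).
Proof. by move=> xy i; rewrite lerD2r. Qed.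

Lemma translate_rotation_monotone k l x :
  rotation_monotone x -> rotation_monotone (translate k l x).
Proof.
move=> mx k' l' kl'; rewrite translateD (addrC k') (addrC l') -translateD.
by apply: translate_le; exact: mx.
Qed.

Lemma rotation_monotone_lt x k l k' l' : rotation_monotone x ->
  phase k l < phase k' l' -> seq_le (translate k l x) (translate k' l' x).
Proof.
move=> mx kl.
have -> : translate k' l' x = translate k l (translate (k' - k) (l' - l) x).
  by rewrite translateD !(addrC _ (_ - _)) !subrK.
apply: translate_le; apply: mx.
by rewrite phaseD phaseN subr_gt0.
Qed.

Lemma rotation_number_bound x (e : R) : has_rotation_number x nu -> 0 < e ->
  exists N, forall i, (N <= absz i)%N -> `|x i - i%:~R * nu| <= e * `|i%:~R|.
Proof.
move=> [xp xn] e0.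
have [N1 _ h1] := (cvgrPdist_le _ _).1 xp e e0.
have [N2 _ h2] := (cvgrPdist_le _ _).1 xn e e0.
exists (maxn N1 N2).+1 => i Ni.
have i0 : i%:~R != 0 :> R by rewrite intr_eq0; lia.
suff : `|nu - x i / i%:~R| <= e.
  rewrite -(ler_pM2r (_ : 0 < `|i%:~R : R|)) ?normr_gt0// -normrM.
  by rewrite mulrBl divfK// distrC mulrC.
case: i Ni i0 => n Nn i0; first by apply: h1 => /=; lia.
have := h2 n.+1; rewrite /= NegzE intrN; apply.
by lia.
Qed.

(** If the translate by (k, l) were below x although l - k nu > 0, iterating would
give x_{-nk} + n l <= x_0 for all n, against x_{-nk} = - n k nu + o(n). *)
Lemma birkhoff_rotation_monotone x :
  birkhoff x -> has_rotation_number x nu -> rotation_monotone x.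
Proof.
move=> bx rx k l kl; have [le|//] := bx k l.
(* The inequality for the translate, iterated along the multiples of k. *)
have iter n : x (- (n%:Z * k)) + n%:R * l%:~R <= x 0.
  elim: n => [|n ih]; first by rewrite mul0r oppr0 mul0r addr0.
  have := le (- (n%:Z * k)); rewrite /translate.
  rewrite (_ : - (n%:Z * k) - k = - (n.+1%:Z * k)); last by lia.
  by rewrite -natr1; lra.
have [k0|k0] := eqVneq k 0.
  have := iter 1%N; rewrite mul1r k0 oppr0.
  by move: kl; rewrite k0 /phase; lra.
(* Beyond N the deviation of x from linear growth at - n k is at most n d / 2,
which for n > 2 |x_0| / d leaves no room for the iterated inequality. *)
pose d := phase k l.
have d0 : 0 < d by [].
have kk0 : 0 < `|k%:~R : R| by rewrite normr_gt0 intr_eq0.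
have [N hN] := rotation_number_bound rx (divr_gt0 d0 (mulr_gt0 (ltr0n R 2) kk0)).
pose M := Num.bound (2 * `|x 0| / d).
have hM : 2 * `|x 0| / d < M%:R.
  apply: archi_boundP; apply: divr_ge0; last exact: ltW.
  by apply: mulr_ge0 => //; exact: ler0n.
pose n := (maxn N M).+1.
have /hN : (N <= absz (- (n%:Z * k))%R)%N.
  by rewrite abszN abszM; nia.
rewrite intrN intrM normrN normrM.
rewrite (_ : n%:~R = n%:R) //.
have -> : d / (2 * `|k%:~R|) * (`|n%:R| * `|k%:~R|) = n%:R * d / 2 :> R.
  by rewrite normr_nat; field; rewrite gt_eqF.
rewrite ler_norml => /andP[h _].
have := iter n => h2.
have h3 : n%:R * d / 2 <= x 0.
  have : n%:R * d = n%:R * l%:~R - n%:R * k%:~R * nu by rewrite /d /phase; ring.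
  by lra.
have h4 : 2 * `|x 0| < n%:R * d.
  rewrite -ltr_pdivrMr//; apply: lt_le_trans hM _; rewrite ler_nat /n; lia.
by have := ler_norm (x 0); lra.
Qed.

Lemma rotation_monotone_width n : exists2 D : R, 0 <= D & forall x, rotation_monotone x ->
  forall i m, (m <= n)%N -> `|x i - x (i + m%:Z)| <= D.
Proof.
pose N := Num.bound `|nu|.
have hN : `|nu| < N%:R by exact: archi_boundP.
exists (n%:R * N%:R); first by rewrite mulr_ge0.
move=> x mx i m mn.
suff : `|x i - x (i + m%:Z)| <= m%:R * N%:R.
  by move=> h; apply: le_trans h _; rewrite ler_wpM2r// ler_nat.
case: m {mn} => [|m]; first by rewrite addr0 subrr normr0 mul0r.
have m0 : 0 < m.+1%:R :> R by rewrite ltr0n.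
move: hN; rewrite ltr_norml => /andP[n1 n2].
have p1 : 0 < phase m.+1%:Z (m.+1%:Z * N%:Z).
  rewrite /phase intrM -mulrBr mulr_gt0// subr_gt0//.
have p2 : 0 < phase (- m.+1%:Z) (m.+1%:Z * N%:Z).
  rewrite /phase intrM intrN mulNr opprK -mulrDr mulr_gt0//.
  by move: n1; rewrite -subr_gt0 opprK addrC.
have := mx _ _ p1 (i + m.+1%:Z); have := mx _ _ p2 i.
rewrite /translate opprK addrK intrM => h1 h2.
by rewrite ler_norml; apply/andP; split; lra.
Qed.

(** Both sequences stay at bounded distance from i nu, since x_i and x_0 + i nu
can be compared up to the integer part of i nu. *)
Lemma rotation_monotone_close x y : rotation_monotone x -> rotation_monotone y ->
  exists2 D : R, 0 <= D & forall i, `|x i - y i| <= D.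
Proof.
move=> mx my.
have half u v i : rotation_monotone u -> rotation_monotone v ->
    u i - v i <= u 0 - v 0 + 2.
  move=> mu mv; pose l := Num.floor (i%:~R * nu) + 1.
  have := floor_itv (i%:~R * nu); rewrite -/l => /andP[l1 l2].
  have p1 : 0 < phase i l by rewrite subr_gt0.
  have p2 : 0 < phase (- i) (- (l - 2)).
    rewrite phaseN /phase intrD /l intrD; move: l1; lra.
  have := mu _ _ p1 i; have := mv _ _ p2 0.
  by rewrite /translate subrr sub0r opprK intrN intrD; lra.
exists (`|x 0 - y 0| + 2) => [|i]; first by rewrite addr_ge0.
rewrite ler_norml.
have := half _ _ i mx my; have := half _ _ i my mx.
have := ler_norm (x 0 - y 0); have := ler_norm (- (x 0 - y 0)).
by rewrite normrN => ? ? ? ?; apply/andP; split; lra.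
Qed.

Hypothesis nu_irr : irrational nu.

Lemma phase_neq0 k l : k != 0 -> phase k l != 0.
Proof.
move=> k0; apply/eqP => /subr0_eq e; apply: nu_irr.
exists (l%:~R / k%:~R) => //=.
rewrite fmorph_div !rmorph_int e mulrC mulKf//.
by rewrite intr_eq0.
Qed.

(** With g the phase and q the integer part of 1/g, the remainder 1 - q g is a phase
strictly between 0 and g by irrationality; either it or its complement in g is
at most g/2. *)
Lemma phase_halving k l : 0 < phase k l < 1 ->
  exists p : int * int, 0 < phase p.1 p.2 <= phase k l / 2.
Proof.
move=> /andP[g0 g1]; set g := phase k l in g0 g1 *.
have k0 : k != 0.
  apply/eqP => k0; move: g0 g1; rewrite /g /phase k0 mul0r subr0.
  by rewrite ltr0z (ltrz1 R l); lia.
pose q := Num.floor g^-1.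
have /andP[q1 q2] := floor_itv g^-1; rewrite -/q in q1 q2.
have q0 : q != 0.
  apply/eqP => q0; move: q2; rewrite q0 add0r => /ltW.
  by rewrite invr_le1 ?unitfE ?gt_eqF// leNgt g1.
pose k' := - (q * k); pose l' := 1 - q * l.
have e : phase k' l' = 1 - q%:~R * g.
  by rewrite /phase /k' /l' /g /phase intrN intrM intrD intrN intrM; ring.
have r0 : 0 <= 1 - q%:~R * g by rewrite subr_ge0 -ler_pdivlMr// mul1r.
have r1 : 1 - q%:~R * g < g.
  move: q2; rewrite -(ltr_pM2r g0) mulVf ?gt_eqF// intrD mulrDl; lra.
have rn : 1 - q%:~R * g != 0.
  by rewrite -e phase_neq0// oppr_eq0 mulf_neq0.
have {}r0 : 0 < 1 - q%:~R * g by rewrite lt_def rn.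
have [h|h] := leP (1 - q%:~R * g) (g / 2).
  by exists (k', l'); rewrite /= e r0.
exists (k - k', l - l'); rewrite /= phaseD phaseN e -/g.
by apply/andP; split; lra.
Qed.

Lemma phase_sequence : exists gk gl : nat -> int,
  [/\ forall n, 0 < phase (gk n) (gl n),
      forall n, phase (gk n.+1) (gl n.+1) < phase (gk n) (gl n) &
      forall n, phase (gk n) (gl n) <= n.+1%:R^-1].
Proof.
have /choice[f fP] : forall p : int * int, exists p' : int * int,
    0 < phase p.1 p.2 < 1 -> 0 < phase p'.1 p'.2 <= phase p.1 p.2 / 2.
  move=> [k l]; have [h|h] := pselect (0 < phase k l < 1).
    by have [p' ?] := phase_halving h; exists p'.
  by exists (0, 0).
pose g n := iter n f (- 1, - Num.floor nu).
have g0 : 0 < phase (g 0%N).1 (g 0%N).2 < 1.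
  have := floor_itv nu; rewrite intrD => /andP[h1 h2].
  have : phase (- 1) (- Num.floor nu) != 0 by apply: phase_neq0.
  rewrite /= lt_def => -> /=; rewrite phaseN /phase; apply/andP; split; lra.
have gP n : 0 < phase (g n).1 (g n).2 < 1.
  elim: n => // n ih; have /andP[h1 h2] := fP _ ih.
  by rewrite [g _]/= h1 /=; move: ih => /andP[? ?]; lra.
have gS n : phase (g n.+1).1 (g n.+1).2 <= phase (g n).1 (g n).2 / 2.
  by have /andP[] := fP _ (gP n).
exists (fun n => (g n).1), (fun n => (g n).2); split => n.
- by case/andP: (gP n).
- by have := gS n; case/andP: (gP n); lra.
- rewrite -[leRHS]mul1r ler_pdivlMr ?ltr0n//; elim: n => [|n ih].
    by rewrite mulr1 ltW//; case/andP: (gP 0%N).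
  have := gS n; case/andP: (gP n) => h1 _ h2.
  have h3 : (phase (g n.+1).1 (g n.+1).2) * n.+2%:R <=
    phase (g n).1 (g n).2 / 2 * n.+2%:R by rewrite ler_wpM2r.
  apply: le_trans h3 _; apply: le_trans ih.
  rewrite -mulrA; apply: ler_wpM2l; first exact: ltW.
  by rewrite ler_pdivrMl// -natrM ler_nat; lia.
Qed.

(** For each k the positive phases l - k nu have a least element.  Consequently
translations whose phases tend to 0 have shifts k tending to infinity. *)
Lemma phase_lower_bound (N : nat) : exists2 d : R, 0 < d &
  forall k l, (absz k <= N)%N -> 0 < phase k l -> d <= phase k l.
Proof.
have one k : exists2 d : R, 0 < d & forall l, 0 < phase k l -> d <= phase k l.
  have /andP[f1 f2] := floor_itv (k%:~R * nu).
  exists (phase k (Num.floor (k%:~R * nu) + 1)); first by rewrite subr_gt0.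
  move=> l; rewrite subr_gt0 lerD2r ler_int => h.
  have : (Num.floor (k%:~R * nu))%:~R < (l%:~R : R) by apply: le_lt_trans h.
  by rewrite ltr_int; lia.
elim: N => [|N [d d0 ih]].
  have [d d0 dP] := one 0; exists d => // k l k0; have -> : k = 0 by lia.
  exact: dP.
have [d1 d10 h1] := one N.+1%:Z; have [d2 d20 h2] := one (- N.+1%:Z).
exists (Num.min d (Num.min d1 d2)); first by rewrite !lt_min d0 d10.
move=> k l kN p0; rewrite !ge_min.
have [kN'|kN'] := leqP (absz k) N; first by rewrite ih.
have [e|e] : k = N.+1%:Z \/ k = - N.+1%:Z by lia.
  by rewrite e in p0 *; rewrite h1// orbT.
by rewrite e in p0 *; rewrite h2// !orbT.
Qed.

End Rotation.

(** * Gluing minimizers *)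

Section Gluing.
Variables (R : realType) (r : nat) (lam : R) (F : 'I_r -> R -> R -> R).
Hypotheses (r_gt0 : (0 < r)%N) (lam_gt0 : 0 < lam).
Hypothesis hF : twist_coupling lam F.
Variable nu : R.
Implicit Types (x y z w : int -> R) (a b i j k l : int) (m n : nat).

Local Notation s := (coupling_energy F).
Local Notation W := (window_energy F).

Lemma window_energy_translate a n k l x :
  W a n (translate k l x) = W (a - k) n x.
Proof.
have per (j : 'I_r) (u v : R) (p : int) : F j (u + p%:~R) (v + p%:~R) = F j u v.
  have pern (q : nat) u' v' : F j (u' + q%:R) (v' + q%:R) = F j u' v'.
    elim: q => [|q ih]; first by rewrite !addr0.
    by rewrite -natr1 !addrA (coupling_periodic hF).
  case: p => p; first exact: pern.
  by rewrite -(pern p.+1) NegzE mulrNz !subrK.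
apply: eq_bigr => p _; apply: eq_bigr => j _.
by rewrite /translate per; congr (F j (x _) (x _)); ring.
Qed.

Lemma minimizer_translate k l x : minimizer F x -> minimizer F (translate k l x).
Proof.
move=> mx a n z xz.
have -> : z = translate k l (translate (- k) (- l) z).
  by rewrite translateD !subrr translate0.
rewrite window_energy_translate [leRHS]window_energy_translate; apply: mx => i.
rewrite /translate opprK => h; have : z (i + k) != translate k l x (i + k).
  by apply: contra h => /eqP ->; rewrite /translate addrK intrN addrK.
by move=> /xz; lia.
Qed.

(** The constant depends only on a bound [D] for the oscillation of x over a site
and for its distance to the other sequence, not on their size. *)
Lemma coupling_energy_lipschitz (D : R) : 0 <= D -> exists2 C : R, 0 <= C &
  forall i x x' (d : R), (forall m, (m <= r)%N -> `|x i - x (i + m%:Z)| <= D) ->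
    (forall j, i <= j <= i + r%:Z -> `|x j - x' j| <= D /\ `|x j - x' j| <= d) ->
    `|s i x - s i x'| <= C * d.
Proof.
move=> D0; have [C C0 FC] := coupling_lipschitz hF D0.
exists (r%:R * (C * 2)); first by rewrite !mulr_ge0.
move=> i x x' d xD xx'.
rewrite -sumrB; apply: le_trans (ler_norm_sum _ _ _) _.
rewrite -mulrA -[r in r%:R]card_ord mulr_natl -sumr_const.
apply: ler_sum => j _; have jr := ltn_ord j.
have [h1 h2] := xx' i (ltac:(lia)).
have [h3 h4] := xx' (i + j.+1%:Z) (ltac:(lia)).
apply: le_trans (FC _ _ _ _ _ (xD _ jr) h1 h3) _.
by rewrite -mulrA ler_wpM2l//; lra.
Qed.

(** Paste z into x and max(x, y) into y over the window.  By minimality neither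
energy decreases.  On the interior sites min + max <= x + y bounds the gain, and
the r sites at each end, where the pasted sequences return to x and y, cost at
most a constant times d each. *)
Lemma gain_bound x y : minimizer F x -> minimizer F y ->
  rotation_monotone nu x -> rotation_monotone nu y ->
  exists2 C : R, 0 <= C & forall a n (d : R) z,
    differ_within r a n (seq_min x y) z ->
    (forall j, (a - r%:Z <= j < a + r%:Z) || (a + n%:Z <= j < a + n%:Z + 2 * r%:Z) ->
       `|x j - y j| <= d) ->
    W a n (seq_min x y) - W a n z <= C * d.
Proof.
move=> mx my rx ry.
have [D1 D10 hD1] := rotation_monotone_width nu r.
have [D2 D20 hD2] := rotation_monotone_close rx ry.
have [C C0 hC] := coupling_energy_lipschitz (addr_ge0 D10 D20).
exists (4 * r%:R * C); first by rewrite !mulr_ge0.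
move=> a n d z mz hd; set m := seq_min x y in mz *.
pose M := seq_max x y.
pose inside j := (a <= j < a + n%:Z + r%:Z).
pose x' j := if inside j then z j else x j.
pose y' j := if inside j then M j else y j.
have zm j : (j < a + r%:Z) || (a + n%:Z <= j) -> z j = m j.
  by move=> jh; apply/eqP; apply/negP => /negP /mz; lia.
have xm j : `|x j - m j| <= `|x j - y j| /\ `|y j - M j| <= `|x j - y j|.
  rewrite /m /M /seq_min /seq_max.
  by case: (leP (x j) (y j)) => _; split; rewrite ?subrr ?normr0// distrC.
have xx' : W (a - r%:Z) (r + n + r) x <= W (a - r%:Z) (r + n + r) x'.
  by apply: mx => j; rewrite /x'; case: ifP; rewrite ?eqxx//; rewrite /inside; lia.
have yy' : W (a - r%:Z) (r + n + r) y <= W (a - r%:Z) (r + n + r) y'.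
  by apply: my => j; rewrite /y'; case: ifP; rewrite ?eqxx//; rewrite /inside; lia.
have edge b : b = a - r%:Z \/ b = a + n%:Z ->
    W b r x' - W b r x <= r%:R * (C * d) /\ W b r y' - W b r y <= r%:R * (C * d).
  move=> bb.
  have per u u' : rotation_monotone nu u ->
      (forall j, b <= j < b + 2 * r%:Z -> `|u j - u' j| <= `|x j - y j|) ->
      W b r u' - W b r u <= r%:R * (C * d).
    move=> ru uu'; rewrite -sumrB -[r in r%:R]card_ord mulr_natl -sumr_const.
    apply: ler_sum => p _; have pr := ltn_ord p.
    apply: le_trans (ler_norm _) _; rewrite distrC; apply: hC.
      by move=> q qr; apply: le_trans (hD1 _ ru _ _ qr) _; rewrite lerDl.
    move=> j jh; have uj := uu' j (ltac:(lia)); split.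
      by apply: le_trans uj _; apply: le_trans (hD2 j) _; rewrite lerDr.
    by apply: le_trans uj _; apply: hd; case: bb => e; lia.
  split; apply: per => // j jh.
    rewrite /x'; case: ifP => _; last by rewrite subrr normr0.
    by rewrite zm; [case: (xm j)|case: bb => e; lia].
  rewrite /y'; case: ifP => _; last by rewrite subrr normr0.
  by case: (xm j).
move: xx' yy'; rewrite !window_energy_cat subrK.
have -> : a - r%:Z + (r + n)%N%:Z = a + n%:Z by lia.
have [e1 e2] := edge (a - r%:Z) (or_introl erefl).
have [e3 e4] := edge (a + n%:Z) (or_intror erefl).
have mid := window_minmax lam_gt0 hF a n x y; rewrite -/m -/M in mid.
rewrite (@window_energy_local _ _ F a n x' z); last first.
  by move=> j jh; rewrite /x' /inside jh.
rewrite (@window_energy_local _ _ F a n y' M); last first.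
  by move=> j jh; rewrite /y' /inside jh.
have -> : 4 * r%:R * C * d = 4 * (r%:R * (C * d)) by ring.
by lra.
Qed.

Lemma asymptotic_min x y : minimizer F x -> minimizer F y ->
  rotation_monotone nu x -> rotation_monotone nu y ->
  (forall d : R, 0 < d -> exists N, forall i, (N <= absz i)%N -> `|x i - y i| <= d) ->
  minimizer F (seq_min x y).
Proof.
move=> mx my rx ry xy a n z mz.
have [C C0 hC] := gain_bound mx my rx ry.
apply/ler_addgt0Pl => e e0.
have d0 : 0 < e / (C + 1) by rewrite divr_gt0//; lra.
have [N hN] := xy _ d0.
(* Both edges of the window [-M, M) lie where x and y are close. *)
pose M := (absz a + n + N + 2 * r)%N.
rewrite -lerBlDr.
have mz' : differ_within r (- M%:Z) (M + M) (seq_min x y) z.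
  by move=> i /mz; rewrite /M; lia.
rewrite -(@window_energy_enlarge _ _ F a n (- M%:Z) (M + M) _ _ mz); last 2 first.
- by rewrite /M; lia.
- by rewrite /M; lia.
have := hC _ _ (e / (C + 1)) _ mz' => h.
apply: le_trans (h _) _.
  by move=> j jh; apply: hN; move: jh; rewrite /M; lia.
by rewrite mulrCA ger_pMr// ler_pdivrMr ?mul1r; lra.
Qed.

(** No site sees two modifications made in disjoint windows, so their effects on
the energy add up. *)
Lemma gain_add x a n b m z w : differ_within r a n x z -> differ_within r b m x w ->
  (a + n%:Z <= b) || (b + m%:Z <= a) ->
  exists c p v, differ_within r c p x v /\
    W c p x - W c p v = (W a n x - W a n z) + (W b m x - W b m w).
Proof.
wlog ab : a n b m z w / a + n%:Z <= b.
  move=> wl xz xw /orP[ab|ba]; first by apply: wl => //; rewrite ab.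
  have [|c [p [v [h1 h2]]]] := wl _ _ _ _ _ _ ba xw xz; first by rewrite ba.
  by exists c, p, v; split=> //; rewrite h2 addrC.
move=> xz xw _.
have zx j : (j < a + r%:Z) || (a + n%:Z <= j) -> z j = x j.
  by move=> jh; apply/eqP; apply/negP => /negP /xz; lia.
have wx j : (j < b + r%:Z) || (b + m%:Z <= j) -> w j = x j.
  by move=> jh; apply/eqP; apply/negP => /negP /xw; lia.
pose q := absz (b - (a + n%:Z))%R.
pose v j := z j + (w j - x j).
exists a, (n + (q + m))%N, v; split.
  move=> j; have [jz|jz] := eqVneq (z j) (x j).
    have [jw|jw] := eqVneq (w j) (x j).
      by rewrite /v jz jw subrr addr0 eqxx.
    by have := xw j jw; rewrite /q; lia.
  by have := xz j jz; rewrite /q; lia.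
rewrite !window_energy_cat.
have -> : a + n%:Z + q%:Z = b by rewrite /q; lia.
rewrite (@window_energy_local _ _ F a n v z); last first.
  by move=> j jh; rewrite /v wx ?subrr ?addr0//; lia.
rewrite (@window_energy_local _ _ F b m v w); last first.
  by move=> j jh; rewrite /v zx; [ring|lia].
rewrite (@window_energy_local _ _ F (a + n%:Z) q v x); last first.
  by move=> j; rewrite /q => jh; rewrite /v zx ?wx; [ring|lia|lia].
by ring.
Qed.

(** A modification that lowers the energy of min(X, Y) lowers by a fixed amount the
energy of infinitely many far translates of min(x, y); carried back, these are
modifications of min(x, y) on disjoint windows whose gains add up without
bound, against [gain_bound]. *)
Lemma recurrent_min x y (gk gl : nat -> int) X Y :
  minimizer F x -> minimizer F y ->
  rotation_monotone nu x -> rotation_monotone nu y ->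
  (forall N, \forall p \near \oo, (N < absz (gk p))%N) ->
  (forall i, (fun p => translate (gk p) (gl p) x i) @ \oo --> X i) ->
  (forall i, (fun p => translate (gk p) (gl p) y i) @ \oo --> Y i) ->
  minimizer F (seq_min X Y).
Proof.
move=> mx my rx ry gN xX yY a n z mz; rewrite leNgt; apply/negP => lt.
set m := seq_min X Y in mz lt; pose mu := seq_min x y.
pose u p := translate (gk p) (gl p) mu.
pose v p i := u p i + (z i - m i).
have um i : (fun p => u p i) @ \oo --> m i.
  rewrite /m /seq_min minr_absE.
  rewrite (_ : (fun p => _) = fun p =>
    ((translate (gk p) (gl p) x i + translate (gk p) (gl p) y i) -
     `|translate (gk p) (gl p) x i - translate (gk p) (gl p) y i|) / 2); last first.
    by apply/funext => p; rewrite -minr_absE /u /mu /translate /seq_min addr_minl.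
  apply: cvgM; last exact: cvg_cst.
  apply: cvgB; first exact: cvgD.
  by apply: cvg_norm; exact: cvgB.
have vz i : (fun p => v p i) @ \oo --> z i.
  rewrite -[X in _ --> X](_ : m i + (z i - m i) = z i); last by ring.
  by apply: cvgD => //; exact: cvg_cst.
pose e := (W a n m - W a n z) / 2.
have e0 : 0 < e by rewrite divr_gt0// subr_gt0.
have gain_near : \forall p \near \oo, e < W a n (u p) - W a n (v p).
  apply: (cvgr_gt (W a n m - W a n z)); last by rewrite /e; lra.
  by apply: cvgB; apply: (window_energy_cvg hF).
(* Each step adds a far translate whose window avoids the one built so far. *)
have many c : exists b q w, differ_within r b q mu w /\
    c%:R * e <= W b q mu - W b q w.
  elim: c => [|c [b [q [w [muw hc]]]]].
    exists 0, 0%N, mu; split; first by move=> i; rewrite eqxx.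
    by rewrite subrr mul0r.
  have [p [gp hp]] : exists p,
      (absz a + n + absz b + q < absz (gk p))%N /\ e < W a n (u p) - W a n (v p).
    near \oo => p; exists p; split; near: p; [exact: gN|exact: gain_near].
  pose w' := translate (- gk p) (- gl p) (v p).
  have vE : v p = translate (gk p) (gl p) w'.
    by rewrite translateD !subrr translate0.
  have muw' : differ_within r (a - gk p) n mu w'.
    move=> i h; have : z (i + gk p) != m (i + gk p).
      apply: contra h => /eqP h.
      by rewrite /w' /translate opprK /v h subrr addr0 /u /translate addrK intrN addrK.
    by move=> /mz; lia.
  have [|b' [q' [w'' [h1 h2]]]] := gain_add muw muw'; first by lia.
  exists b', q', w''; split=> //; rewrite h2.
  rewrite -!(window_energy_translate a n (gk p) (gl p)) -vE -/(u p) -natr1 mulrDl mul1r.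
  by rewrite lerD// ltW.
have [C C0 hC] := gain_bound mx my rx ry.
have [D D0 hD] := rotation_monotone_close rx ry.
have CD0 : 0 <= C * D / e.
  by apply: divr_ge0; [exact: mulr_ge0|exact: ltW].
have [b [q [w [muw hc]]]] := many (Num.bound (C * D / e)).
have := hC _ _ D _ muw (fun j _ => hD j).
have := archi_boundP CD0; rewrite ltr_pdivrMr//.
by rewrite -/mu; lra.
Unshelve. all: by end_near. Qed.

(** If |x_i - y_i| > d then no translate of X takes at i a value in the interval of
length d below X_i; since the translates of X have at i the values X_j + l, the
fractional parts of the X_i at such sites are d-separated, and there are
finitely many of them by the pigeonhole principle. *)
Lemma gaps_vanish x y X : irrational nu -> seq_le x X -> seq_le y X ->
  (forall k l, 0 < phase nu k l -> seq_le (translate (- k) (- l) X) x) ->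
  (forall k l, 0 < phase nu k l -> seq_le (translate (- k) (- l) X) y) ->
  forall d : R, 0 < d -> exists N, forall i, (N <= absz i)%N -> `|x i - y i| <= d.
Proof.
move=> nu_irr xX yX Xx Xy d d0.
(* The translate of X by (i - j, l) has negative phase, hence lies below x and y,
and its value at i is X_j + l. *)
have sep i j l : 0 < phase nu (j - i) (- l) -> d < `|x i - y i| ->
    d < X i - (X j + l%:~R).
  move=> p h; have := Xx _ _ p i; have := Xy _ _ p i.
  rewrite /translate !opprK (_ : i + (j - i) = j); last by ring.
  have := xX i; have := yX i; move: h.
  by case: (lerP (x i) (y i)) => ?; lra.
pose fl i := Num.floor (X i).
pose t i := X i - (fl i)%:~R.
have tP i : 0 <= t i < 1.
  have := floor_itv (X i); rewrite intrD /t -/(fl i) => /andP[? ?].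
  by apply/andP; split; lra.
pose f i := absz (Num.floor (t i / d)).
pose M := (Num.bound d^-1).
have hM : d^-1 < M%:R by apply: archi_boundP; rewrite invr_ge0 ltW.
have t0 i : 0 <= Num.floor (t i / d).
  rewrite floor_ge0; apply: divr_ge0; last exact: ltW.
  by case/andP: (tP i).
have fM i : (f i < M.+1)%N.
  rewrite ltnS -(ler_nat R).
  have -> : (f i)%:R = (Num.floor (t i / d))%:~R :> R.
    by rewrite /f -[in RHS](gez0_abs (t0 i)).
  have /andP[h _] := floor_itv (t i / d).
  apply: le_trans h _; apply: le_trans (ltW hM).
  by rewrite ler_pdivrMr// mulVf ?gt_eqF// ltW//; case/andP: (tP i).
have finj i j : d < `|x i - y i| -> d < `|x j - y j| -> f i = f j -> i = j.
  move=> hi hj fij; apply/eqP; apply/negP => /negP ij.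
  have fe : Num.floor (t i / d) = Num.floor (t j / d).
    by have := t0 i; have := t0 j; move: fij; rewrite /f; lia.
  have tt : `|t i - t j| < d.
    have := floor_itv (t i / d); have := floor_itv (t j / d).
    rewrite fe intrD !ler_pdivlMr// !ltr_pdivrMr// => /andP[? ?] /andP[? ?].
    by rewrite ltr_norml; apply/andP; split; lra.
  move: tt; rewrite ltr_norml => /andP[tt1 tt2].
  pose l := fl i - fl j.
  have ij0 : i - j != 0 by rewrite subr_eq0.
  have := phase_neq0 nu_irr l ij0; rewrite neq_lt => /orP[p|p].
    have := sep i j l; rewrite -opprB phaseN oppr_gt0 => /(_ p hi).
    by rewrite /l intrD intrN; move: tt1 tt2; rewrite /t; lra.
  have := sep j i (- l); rewrite opprK => /(_ p hj).
  by rewrite intrN /l intrD intrN; move: tt1 tt2; rewrite /t; lra.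
have /choice[g gP] : forall q : nat, exists i, forall j,
    d < `|x j - y j| -> f j = q -> j = i.
  move=> q; have [[i [hi fi]]|no] := pselect (exists i, d < `|x i - y i| /\ f i = q).
    by exists i => j hj fj; apply: finj => //; rewrite fj.
  by exists 0 => j hj fj; exfalso; apply: no; exists j.
exists (\sum_(q < M.+1) absz (g q)).+1 => i; rewrite leNgt => Ni.
apply/negP => hi; have := gP _ i hi erefl => ig.
move: Ni; rewrite (bigD1 (Ordinal (fM i)))//= -ig; lia.
Qed.

(** Here X and Y are the limits of the translates of x and y along one sequence of
translations with phases decreasing to 0. *)
Lemma birkhoff_minimizers_comparable x y : irrational nu ->
  minimizer F x -> minimizer F y ->
  rotation_monotone nu x -> rotation_monotone nu y -> seq_le x y \/ seq_le y x.
Proof.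
move=> nu_irr mx my rx ry.
have [gk [gl [g0 gS glim]]] := phase_sequence nu_irr.
have gsmall (d : R) : 0 < d -> \forall p \near \oo, phase nu (gk p) (gl p) < d.
  move=> d0; near=> p; apply: le_lt_trans (glim p) _.
  by near: p; exact: (near_infty_natSinv_lt (PosNum d0)).
have gN N : \forall p \near \oo, (N < absz (gk p))%N.
  have [d d0 hd] := phase_lower_bound nu N.
  near=> p; rewrite ltnNge; apply/negP => kN; have := hd _ _ kN (g0 p).
  by rewrite leNgt => /negP; apply; near: p; exact: gsmall.
have gdec : {homo (fun p => phase nu (gk p) (gl p)) : p q / (p < q)%N >-> q < p}.
  by apply: (homo_ltn (r := fun u v : R => v < u)) => // v u w /[swap]; exact: lt_trans.
have upper u : rotation_monotone nu u -> exists U : int -> R,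
    [/\ forall i, (fun p => translate (gk p) (gl p) u i) @ \oo --> U i,
        seq_le u U & forall k l, 0 < phase nu k l -> seq_le U (translate k l u)].
  move=> ru; exists (fun i => inf (range (fun p => translate (gk p) (gl p) u i))).
  have cv i : (fun p => translate (gk p) (gl p) u i) @ \oo -->
      inf (range (fun p => translate (gk p) (gl p) u i)).
    apply: nonincreasing_cvgn.
      move=> p q; rewrite leq_eqVlt => /orP[/eqP -> //|/gdec pq].
      exact: rotation_monotone_lt pq i.
    by exists (u i) => _ [p _ <-]; exact: ru (g0 p) i.
  split=> // [i|k l p0 i].
    apply: (ler_cvg_to (cvg_cst (u i)) (cv i)).
    by apply: nearW => p; exact: ru (g0 p) i.
  apply: (ler_cvg_to (cv i) (cvg_cst (translate k l u i))).
  near=> p.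
  have kl : phase nu (gk p) (gl p) < phase nu k l by near: p; exact: gsmall.
  exact: (rotation_monotone_lt ru kl i).
have [X [cX xX Xx]] := upper x rx; have [Y [cY yY Yy]] := upper y ry.
have cvT k l (u U : int -> R) :
    (forall i, (fun p => translate (gk p) (gl p) u i) @ \oo --> U i) ->
    forall i, (fun p => translate (gk p) (gl p) (translate k l u) i) @ \oo -->
      translate k l U i.
  move=> cU i; rewrite (_ : (fun p => _) =
    fun p => translate k l (translate (gk p) (gl p) u) i).
    by apply: cvgD; [exact: cU|exact: cvg_cst].
  by apply/funext => p; rewrite !translateD (addrC k) (addrC l).
have mlim (u U : int -> R) : minimizer F u ->
    (forall i, (fun p => translate (gk p) (gl p) u i) @ \oo --> U i) -> minimizer F U.
  move=> mu; apply: (minimizer_lim hF) => p.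
  exact: minimizer_translate.
have comp (u v U V : int -> R) k l : minimizer F u -> minimizer F v ->
    rotation_monotone nu u -> rotation_monotone nu v ->
    (forall i, (fun p => translate (gk p) (gl p) u i) @ \oo --> U i) ->
    (forall i, (fun p => translate (gk p) (gl p) v i) @ \oo --> V i) ->
    seq_le U (translate k l V) \/ seq_le (translate k l V) U.
  move=> mu mv ru rv cU cV.
  apply: (comparable_of_min r_gt0 lam_gt0 hF).
  - exact: mlim cU.
  - by apply: minimizer_translate; exact: mlim cV.
    apply: (recurrent_min mu (@minimizer_translate k l _ mv) ru _ gN cU (cvT k l _ _ cV)).
    exact: translate_rotation_monotone.
(* If a translate of V of positive phase is below U, shift both down by a
smaller positive phase: U falls below u, and V stays above v. *)
have jump (u v U V : int -> R) k l : rotation_monotone nu v ->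
    (forall k l, 0 < phase nu k l -> seq_le U (translate k l u)) -> seq_le v V ->
    0 < phase nu k l -> seq_le (translate k l V) U -> seq_le v u.
  move=> rv Uu vV kl VU.
  near \oo => p.
  have pk : phase nu (gk p) (gl p) < phase nu k l by near: p; exact: gsmall.
  have h1 := Uu _ _ (g0 p).
  have p1 : 0 < phase nu (- gk p + k) (- gl p + l) by rewrite phaseD phaseN; lra.
  have h2 := rv _ _ p1.
  move=> i; apply: le_trans (h2 i) _.
  rewrite -translateD.
  apply: le_trans (translate_le (- gk p) (- gl p) (translate_le k l vV) i) _.
  apply: le_trans (translate_le (- gk p) (- gl p) VU i) _.
  apply: le_trans (translate_le (- gk p) (- gl p) h1 i) _.
  by rewrite translateD !addNr translate0.
have [[k [l [kl YX]]]|noY] := pselect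
  (exists k l, 0 < phase nu k l /\ seq_le (translate k l Y) X).
  by right; exact: jump Xx yY kl YX.
have [[k [l [kl XY]]]|noX] := pselect
  (exists k l, 0 < phase nu k l /\ seq_le (translate k l X) Y).
  by left; exact: jump Yy xX kl XY.
(* A translate of V of positive phase lies below the translates of v of slightly
larger phase, and the translates of v of small phase tend to V. *)
have below (u v U V : int -> R) : rotation_monotone nu v ->
    (forall k l, 0 < phase nu k l -> seq_le U (translate k l V)) ->
    (forall k l, 0 < phase nu k l -> seq_le V (translate k l v)) ->
    (forall i, (fun p => translate (gk p) (gl p) v i) @ \oo --> V i) -> seq_le U V.
  move=> rv UV Vv cV i.
  apply: (ler_cvg_to (cvg_cst (U i)) (cV i)); apply: nearW => q.
  near \oo => p.
  have pq : 0 < phase nu (gk q - gk p) (gl q - gl p).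
    by rewrite phaseD phaseN subr_gt0; near: p; exact: gsmall.
  apply: le_trans (UV _ _ pq i) _.
  apply: le_trans (translate_le _ _ (Vv _ _ (g0 p)) i) _.
  by rewrite translateD !subrK.
have XY : X = Y.
  apply/funext => i; apply/eqP; rewrite eq_le; apply/andP; split.
    apply: (below x y X Y ry _ Yy cY) => k l kl.
    have [//|h] := comp _ _ _ _ k l mx my rx ry cX cY.
    by exfalso; apply: noY; exists k, l.
  apply: (below y x Y X rx _ Xx cX) => k l kl.
  have [//|h] := comp _ _ _ _ k l my mx ry rx cY cX.
  by exfalso; apply: noX; exists k, l.
have back (u U : int -> R) :
    (forall k l, 0 < phase nu k l -> seq_le U (translate k l u)) ->
    forall k l, 0 < phase nu k l -> seq_le (translate (- k) (- l) U) u.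
  move=> Uu k l kl i; apply: le_trans (translate_le (- k) (- l) (Uu k l kl) i) _.
  by rewrite translateD !addNr translate0.
apply: (comparable_of_min r_gt0 lam_gt0 hF mx my).
apply: (asymptotic_min mx my rx ry).
apply: (gaps_vanish nu_irr xX) => //; rewrite ?XY//; last exact: back.
by rewrite -XY; exact: back.
Unshelve. all: by end_near. Qed.

End Gluing.

Theorem theoremA4 (R : realType) (r : nat) (K lambda : R)
    (hr : (1 <= r)%N) (hK : 0 < K) (hlambda : 0 < lambda)
    (S : 'rV[R]_r.+1 -> R) (hS : weak_twist_energy K lambda S)
    (nu : R) (hnu : irrational nu) :
  strictly_ordered (birkhoff_minimizers S nu).
Proof.
have [F hF SE] := weak_twist_coupling hS.
have minE x : global_minimizers S x -> minimizer F x.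
  move=> gx a n z xz.
  have [nr|rn] := leqP n r.
    have -> // : z = x.
    by apply/funext => i; apply/eqP; apply/negP => /negP /xz; lia.
  have := gx (a + r%:Z) (a + n%:Z - 1) _ (fun i => z i - x i) _.
  have -> : (fun i => x i + (z i - x i)) = z by apply/funext => i; ring.
  have boxE u : box_energy S (a + r%:Z) (a + n%:Z - 1) u = window_energy F a n u.
    rewrite /box_energy.
    have -> : (absz (a + n%:Z - 1 - (a + r%:Z))%R + r).+1 = n by lia.
    by apply: eq_bigr => k _; rewrite SE addrK.
  rewrite !boxE; apply=> [|i ih]; first by lia.
  apply/eqP; rewrite subr_eq0; apply/negP => /negP /xz; lia.
move=> x y [bx gx rx] [by' gy ry] xy.
have mx := minE _ gx; have my := minE _ gy.
have mox := birkhoff_rotation_monotone bx rx.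
have moy := birkhoff_rotation_monotone by' ry.
have [le|le] := birkhoff_minimizers_comparable hr hlambda hF hnu mx my mox moy.
  by have [//|] := ordered_minimizers hr hlambda hF mx my le; left.
by have [/esym//|] := ordered_minimizers hr hlambda hF my mx le; right.
Qed.
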